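(* Let $\sigma$ be a partition of a positive integer $r$ with largest part $\Delta$, let $n,q$ be positive integers, let $H=H(n,r,q\mid\sigma)$, write $s=s(\sigma)$, and let $\alpha,\beta$ be integers with $2\le\alpha\le\beta$. Then: (1) If $s < \alpha \leq \beta$, then the $(\alpha,\beta)$-monochromatic zone of $H$ is empty. (2) If $\alpha \leq \beta < s$ and $n \geq (\beta-\alpha+1) \left\lfloor \frac{s-1}{\alpha-1} \right\rfloor + s$, then the $(\alpha,\beta)$-monochromatic zone of $H$ is empty. (3) If $1 \leq s < \alpha \leq \beta < r$, $q \geq \beta(\Delta-1) +1$ and $n \geq 2s -1$, then every colouring of the vertices of $H$ has an edge containing fewer than $\alpha$ or more than $\beta$ distinct colours; that is, $H$ has no $(\alpha,\beta)$-colouring. (4) If $1 < \alpha \leq \beta < s < r$, $q \geq \beta(\Delta-1) +1$ and $n \geq \left\lfloor \frac{s -1}{\alpha-1} \right\rfloor(s-\alpha)+ 2s-1$, then every colouring of the vertices of $H$ has an edge containing fewer than $\alpha$ or more than $\beta$ distinct colours; that is, $H$ has no $(\alpha,\beta)$-colouring.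
   Context: For a partition $\sigma$ of $r$ and positive integers $n,q$, the $\sigma$-hypergraph $H(n,r,q\mid\sigma)$ is the $r$-uniform hypergraph whose vertex set has $nq$ vertices partitioned into $n$ classes $V_1,\dots,V_n$ of $q$ vertices each, and in which an $r$-subset $K$ of the vertex set is an edge if and only if the multiset of non-zero cardinalities $|K\cap V_i|$, $1\le i\le n$, is exactly the partition $\sigma$. $s(\sigma)$ denotes the number of parts of $\sigma$ and $\Delta$ its largest part. For integers $\alpha\le\beta$, an $(\alpha,\beta)$-colouring of a hypergraph is an assignment of colours to its vertices such that every edge contains at least $\alpha$ and at most $\beta$ distinct colours; a $k$-$(\alpha,\beta)$-colouring is one using exactly $k$ colours. The $(\alpha,\beta)$-monochromatic zone of a $\sigma$-hypergraph is the set of all integers $k$ for which there exists a $k$-$(\alpha,\beta)$-colouring in which every class $V_i$ is monochromatic.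
   Formalization: In (1) and (2) the hypergraph H is additionally assumed to have at least one edge; if H has no edge, the constant colouring is vacuously an (α,β)-colouring, so 1 lies in the monochromatic zone and the claim fails. *)

(* Defs.v *)
From mathcomp Require Import all_boot.

Set Implicit Arguments.
Unset Strict Implicit.
Unset Printing Implicit Defensive.

Definition is_partition (sigma : seq nat) (r : nat) : bool :=
  [&& sorted geq sigma, all (leq 1) sigma & sumn sigma == r].

Definition largest_part (sigma : seq nat) : nat := \max_(m <- sigma) m.

Section SigmaHypergraph.

Variables n q : nat.

Definition vertex : finType := ('I_n * 'I_q)%type.

Definition vclass (i : 'I_n) : {set vertex} := [set v | v.1 == i].

Definition part_sizes (K : {set vertex}) : seq nat :=
  [seq m <- [seq #|K :&: vclass i| | i : 'I_n] | 0 < m].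

(* The edge set of H(n, r, q | sigma); [perm_eq] is equality of multisets. *)
Definition sigma_hypergraph (r : nat) (sigma : seq nat) : {set {set vertex}} :=
  [set K : {set vertex} | (#|K| == r) && perm_eq (part_sizes K) sigma].

Definition monochromatic_classes (c : vertex -> nat) : Prop :=
  forall (i : 'I_n) (u v : vertex),
    u \in vclass i -> v \in vclass i -> c u = c v.

End SigmaHypergraph.

(* Colours are natural numbers: the vertex set is finite, so this loses no
   generality. *)
Definition ncolours (T : finType) (c : T -> nat) (K : {set T}) : nat :=
  size (undup [seq c v | v in K]).

Definition colouring (T : finType) (E : {set {set T}}) (alpha beta : nat)
    (c : T -> nat) : Prop :=
  forall K : {set T}, K \in E -> alpha <= ncolours c K <= beta.

Definition k_colouring (T : finType) (E : {set {set T}}) (alpha beta k : nat)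
    (c : T -> nat) : Prop :=
  colouring E alpha beta c /\ ncolours c [set: T] = k.

(* [monochromatic_zone n q r sigma alpha beta k]: k is in the (alpha, beta)-
   monochromatic zone of H(n, r, q | sigma). A number of colours is never
   negative, so k ranges over nat. *)
Definition monochromatic_zone (n q r : nat) (sigma : seq nat)
    (alpha beta k : nat) : Prop :=
  exists c : vertex n q -> nat,
    k_colouring (sigma_hypergraph n q r sigma) alpha beta k c
    /\ monochromatic_classes c.

(* Main.v *)
Require Import Defs.
From mathcomp Require Import all_boot.
From mathcomp Require Import zify.

(** If every class contains [Delta] vertices of one colour, any [s] classes carry
    an edge with one colour per class, so only the colours [f i] of the classes
    matter. For [s < alpha] such an edge has too few colours. For [beta < s],
    either some [s] classes show more than [beta] colours, or there are at most
    [beta] colours and, by counting, the [alpha - 1] most frequent ones cover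
    [s] classes. In general, a class without [Delta] vertices of one colour has
    more than [beta] colours, since [q > beta * (Delta - 1)]; [s] such classes
    yield greedily an edge with more than [beta] colours, so all but [s - 1]
    classes may be assumed to be of the first kind. *)

Set Implicit Arguments.
Unset Strict Implicit.
Unset Printing Implicit Defensive.

(** * Elementary bounds on sums and subsets of given size *)

Lemma leq_sum_const (I : eqType) (s : seq I) (F : I -> nat) m :
  {in s, forall i, F i <= m} -> \sum_(i <- s) F i <= size s * m.
Proof.
move=> leF; rewrite mulnC -iter_addn_0 -(count_predT s) -big_const_seq.
by rewrite [leqLHS]big_seq [leqRHS]big_seq; apply: leq_sum.
Qed.

Lemma geq_sum_const (I : eqType) (s : seq I) (F : I -> nat) m :
  {in s, forall i, m <= F i} -> size s * m <= \sum_(i <- s) F i.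
Proof.
move=> leF; rewrite mulnC -iter_addn_0 -(count_predT s) -big_const_seq.
by rewrite [leqLHS]big_seq [leqRHS]big_seq; apply: leq_sum.
Qed.

Lemma exists_subset_card (T : finType) (A : {set T}) m :
  m <= #|A| -> exists2 Y : {set T}, Y \subset A & #|Y| = m.
Proof.
move=> /card_geqP[ys [uys sizeys subys]]; exists [set v in ys].
  by apply/subsetP=> v; rewrite inE => /subys.
by rewrite cardsE (card_uniqP uys).
Qed.

(** * Counting colours in a finite coloured set *)

Section Colours.

Variables (T : finType) (c : T -> nat).
Implicit Types A B Y : {set T}.

Lemma leq_ncolours A (s : seq nat) :
  {in A, forall v, c v \in s} -> ncolours c A <= size s.
Proof.
move=> sub; apply: uniq_leq_size; first exact: undup_uniq.
by move=> d; rewrite mem_undup => /imageP[v vA ->]; apply: sub.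
Qed.

Lemma geq_ncolours A (s : seq nat) :
  uniq s -> {subset s <= [seq c v | v in A]} -> size s <= ncolours c A.
Proof.
move=> us sub; apply: uniq_leq_size => // d /sub.
by rewrite mem_undup.
Qed.

Lemma ncoloursU1 B v :
  c v \notin [seq c u | u in B] -> ncolours c (v |: B) = (ncolours c B).+1.
Proof.
move=> vB; apply/eqP; rewrite eqn_leq; apply/andP; split.
  apply: (@leq_ncolours _ (c v :: undup [seq c u | u in B])) => u.
  rewrite in_setU1 inE mem_undup => /orP[/eqP->|uB]; first by rewrite eqxx.
  by rewrite image_f ?orbT.
apply: (@geq_ncolours _ (c v :: undup [seq c u | u in B])).
  by rewrite /= mem_undup vB undup_uniq.
move=> d; rewrite inE mem_undup => /orP[/eqP->|/imageP[u uB ->]].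
  by apply: image_f; rewrite setU11.
by apply: image_f; rewrite setU1r.
Qed.

Lemma ncoloursS A B : A \subset B -> ncolours c A <= ncolours c B.
Proof.
move=> /subsetP AB; apply: leq_ncolours => v /AB vB.
by rewrite mem_undup image_f.
Qed.

(* Greedy choice: while fewer than [m] colours are used, [A] has a vertex of a
   fresh colour. *)
Lemma exists_colourful A B x m :
  x <= #|A| -> m <= ncolours c A ->
  exists Y, [/\ Y \subset A, #|Y| = x
    & minn m (ncolours c B + x) <= ncolours c (B :|: Y)].
Proof.
move=> + mA; elim: x => [_|x IHx xA].
  exists set0; rewrite sub0set cards0 setU0 addn0; split=> //; exact: geq_minr.
have [Y [YA cardY leY]] := IHx (ltnW xA).
have [mBY|BYm] := leqP m (ncolours c (B :|: Y)).
  have [v]: exists v, v \in A :\: Y.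
    apply/set0Pn; rewrite -card_gt0 cardsD (setIidPr YA); lia.
  rewrite inE => /andP[vY vA]; exists (v |: Y).
  rewrite subUset sub1set vA YA cardsU1 vY cardY; split=> //.
  apply: leq_trans (geq_minl _ _) (leq_trans mBY (ncoloursS _)).
  by rewrite setUS // subsetUr.
have [v vA vBY]: exists2 v, v \in A & c v \notin [seq c u | u in B :|: Y].
  (* Without a fresh colour in [A], the set [B :|: Y] would show all colours of [A], hence at least
     [m]. *)
  apply/exists_inP; apply: contraTT BYm; rewrite -leqNgt => /exists_inPn sub.
  apply: leq_trans mA (leq_ncolours _) => v vA.
  by rewrite mem_undup; apply/negbNE/sub.
have vY : v \notin Y.
  by apply: contra vBY => vY; rewrite image_f // inE vY orbT.
exists (v |: Y); rewrite subUset sub1set vA YA cardsU1 vY cardY; split=> //.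
rewrite setUCA ncoloursU1 //; lia.
Qed.

Lemma card_colours A (s : seq nat) : uniq s ->
  #|[set v in A | c v \in s]| = \sum_(d <- s) #|[set v in A | c v == d]|.
Proof.
elim: s => [_|d s IHs /= /andP[ds us]].
  by rewrite big_nil; apply: eq_card0 => v; rewrite !inE andbF.
rewrite big_cons -IHs // -cardsUI (_ : _ :&: _ = set0).
  by rewrite cards0 addn0; apply: eq_card => v; rewrite !inE -andb_orr.
apply/setP=> v; rewrite !inE; apply/negP=> /andP[/andP[_ /eqP->]].
by rewrite (negPf ds) andbF.
Qed.

(** The colours occurring in [A] split it into blocks of at most [m] vertices. *)
Lemma card_leq_ncolours A m :
  (forall d, #|[set v in A | c v == d]| <= m) -> #|A| <= ncolours c A * m.
Proof.
move=> mono; have /eq_card-> : A =i [set v in A | c v \in undup [seq c u | u in A]].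
  by move=> v; rewrite inE mem_undup; case: (boolP (v \in A)) => // /image_f->.
rewrite card_colours ?undup_uniq //.
by apply: leq_sum_const => d _; apply: mono.
Qed.

(* Call a colour big if it occurs more than [t := (s - 1) %/ (alpha - 1)] times;
   [alpha - 1] big colours cover at least [s] vertices. Hence listing the big
   colours first, either the first [alpha - 1] colours cover [s] vertices, or
   each of the remaining ones occurs at most [t] times. *)
Lemma exists_bad_subset A s alpha beta :
  1 < alpha -> alpha <= beta -> beta < s ->
  (beta - alpha + 1) * ((s - 1) %/ (alpha - 1)) + s <= #|A| ->
  exists Y, [/\ Y \subset A, #|Y| = s
    & ncolours c Y < alpha \/ beta < ncolours c Y].
Proof.
move=> alpha_gt1 le_ab lt_bs; set t := _ %/ _ => leA.
have [ltb|leb] := ltnP beta (ncolours c A).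
  (* Starting from [set0], the greedy choice reaches [minn beta.+1 s] colours, which is [beta.+1]
     since [beta < s]. *)
  have sA : s <= #|A| by lia.
  have [Y [YA cardY]] := exists_colourful set0 sA ltb.
  rewrite set0U => leY; exists Y; split=> //; right; lia.
have ltst : s <= (alpha - 1) * t.+1.
  have := ltn_ceil (s - 1) (d := alpha - 1); rewrite -/t; lia.
set C := undup [seq c u | u in A].
pose big d := t < #|[set v in A | c v == d]|.
set D := filter big C ++ filter (predC big) C.
have permD : perm_eq D C by apply/permPl; apply: perm_filterC.
have uD : uniq D by rewrite (perm_uniq permD) undup_uniq.
have sizeD : size D = ncolours c A by rewrite (perm_size permD).
have memD v : v \in A -> c v \in D.
  by move=> vA; rewrite (perm_mem permD) mem_undup image_f.
set top := take (alpha - 1) D.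
have utop : uniq top by exact: take_uniq.
set Z := [set v in A | c v \in top].
have [/exists_subset_card[Y /subsetP YZ cardY]|ltZ] := leqP s #|Z|.
  exists Y; split=> //.
    by apply/subsetP=> v /YZ; rewrite inE => /andP[].
  left; apply: (@leq_ltn_trans (size top)).
    by apply: leq_ncolours => v /YZ; rewrite inE => /andP[].
  by rewrite size_take; case: ifP; lia.
exfalso; rewrite /Z card_colours // in ltZ.
(* With [alpha - 1] big colours available, [top] consists of big colours only and covers at least
   [(alpha - 1) * t.+1 >= s] vertices, against [ltZ]. *)
have [bigC|smallC] := leqP (alpha - 1) (size (filter big C)).
  suff : (alpha - 1) * t.+1 <= \sum_(d <- top) #|[set v in A | c v == d]|.
    by move=> /(leq_trans ltst); rewrite leqNgt ltZ.
  have topE : top = take (alpha - 1) (filter big C) by rewrite /top takel_cat.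
  have <- : size top = alpha - 1 by rewrite topE size_takel.
  apply: geq_sum_const => d; rewrite topE => /mem_take.
  by rewrite mem_filter => /andP[].
(* Otherwise no colour after [top] is big, and at most [beta - alpha + 1] of them remain, so
   [#|A| < s + (beta - alpha + 1) * t], against [leA]. *)
have : #|A| = \sum_(d <- D) #|[set v in A | c v == d]|.
  rewrite -card_colours //; apply: eq_card => v; rewrite inE.
  by case: (boolP (v \in A)) => // /memD ->.
rewrite -(cat_take_drop (alpha - 1) D) big_cat /= -/top.
have : \sum_(d <- drop (alpha - 1) D) #|[set v in A | c v == d]|
    <= size (drop (alpha - 1) D) * t.
  apply: leq_sum_const => d.
  rewrite /D drop_cat ltnNge (ltnW smallC) /= => /mem_drop.
  by rewrite mem_filter /= -leqNgt => /andP[].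
have : size (drop (alpha - 1) D) * t <= (beta - alpha + 1) * t.
  by rewrite leq_mul2r size_drop sizeD; apply/orP; right; lia.
move: ltZ leA; rewrite addnC.
set S1 := \sum_(d <- top) _; set S2 := \sum_(d <- _) _.
(* Abstracting the products leaves a linear goal. *)
move: (_ * t) (_ * t) #|A| S1 S2.
lia.
Qed.

End Colours.

(** * Building edges from prescribed intersections with the classes *)

Section Edges.

Variables (n q r : nat) (sigma : seq nat).
Hypothesis sigma_part : is_partition sigma r.

Let H := sigma_hypergraph n q r sigma.

Lemma part_gt0 m : m \in sigma -> 0 < m.
Proof. by case/and3P: sigma_part => _ /allP pos _ /pos. Qed.

Lemma sumn_sigma : sumn sigma = r.
Proof. by case/and3P: sigma_part => _ _ /eqP. Qed.

Lemma leq_largest_part m : m \in sigma -> m <= largest_part sigma.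
Proof. by move=> ms; apply: leq_bigmax_seq. Qed.

Lemma nth_leq_largest_part i : nth 0 sigma i <= largest_part sigma.
Proof.
have [lt_is|le_si] := ltnP i (size sigma); last by rewrite nth_default.
exact/leq_largest_part/mem_nth.
Qed.

Lemma card_vclass (i : 'I_n) : #|vclass q i| = q.
Proof.
have -> : vclass q i = setX [set i] [set: 'I_q].
  by apply/setP=> v; rewrite !inE andbT.
by rewrite cardsX cards1 cardsT card_ord mul1n.
Qed.

Lemma card_part_sizes (K : {set vertex n q}) : sumn (part_sizes K) = #|K|.
Proof.
have -> : sumn (part_sizes K) = \sum_(i : 'I_n) #|K :&: vclass q i|.
  rewrite /part_sizes sumnE big_filter big_image_cond /= big_mkcond /=.
  by apply: eq_bigr => i _; case: posnP.
rewrite -sum1_card (partition_big (fun v : vertex n q => v.1) predT) //=.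
apply: eq_bigr => i _; rewrite -sum1_card; apply: eq_bigl => v.
by rewrite !inE.
Qed.

(* The class in position [k] of [js] gets the [k]-th part; for a class outside
   [js], [index] overflows and [nth] returns its default [0]. *)
Lemma edge_of_sizes (js : seq 'I_n) (K : {set vertex n q}) :
  uniq js -> size js = size sigma ->
  (forall i, #|K :&: vclass q i| = nth 0 sigma (index i js)) -> K \in H.
Proof.
move=> ujs sjs sizeK.
suff permK : perm_eq (part_sizes K) sigma.
  by rewrite inE permK andbT -card_part_sizes (perm_sumn permK) sumn_sigma.
pose a i := nth 0 sigma (index i js).
have -> : part_sizes K = [seq a i | i <- enum 'I_n & 0 < a i].
  by rewrite /part_sizes /image_mem (eq_map sizeK) filter_map.
have <- : map a js = sigma.
  apply: (@eq_from_nth _ 0); rewrite size_map // => k lt_k.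
  (* [nth] needs a default in ['I_n]; it is taken from [js], which is non-empty because
     [k < size js]. *)
  case: {1}js (lt_k) => [//|j0 _] _.
  by rewrite (nth_map j0) // /a index_uniq.
apply: perm_map; apply: uniq_perm => //.
  exact/filter_uniq/enum_uniq.
move=> i; rewrite mem_filter mem_enum andbT /a.
have [ijs|ijs] := boolP (i \in js).
  by rewrite part_gt0 // mem_nth // -sjs index_mem.
by rewrite nth_default // -sjs memNindex.
Qed.

(** Each part is at most [Delta], so it can be filled by the first elements of [S i]; each part is
    positive, so every class of [J] is met. *)
Lemma edge_inside (J : {set 'I_n}) (S : 'I_n -> {set vertex n q}) :
  #|J| = size sigma -> (forall i, i \in J -> S i \subset vclass q i) ->
  (forall i, i \in J -> largest_part sigma <= #|S i|) ->
  exists2 K, K \in H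
    & (forall v, v \in K -> v.1 \in J /\ v \in S v.1) /\
      (forall i, i \in J -> exists2 v, v \in K & v \in S i).
Proof.
move=> cardJ subS leS; pose js := enum J.
have ujs : uniq js by exact: enum_uniq.
have sjs : size js = size sigma by rewrite -cardE.
pose a i := nth 0 sigma (index i js).
have a_gt0 i : (0 < a i) = (i \in J).
  have [iJ|iJ] := boolP (i \in J).
    by rewrite part_gt0 // mem_nth // -sjs index_mem mem_enum.
  by rewrite /a nth_default // -sjs memNindex // mem_enum.
pose K := [set v : vertex n q | v \in take (a v.1) (enum (S v.1))].
have memK v : v \in K -> v.1 \in J /\ v \in S v.1.
  rewrite inE => vK; split; last by move/mem_take: vK; rewrite mem_enum.
  by rewrite -a_gt0; case: (a v.1) vK => //; rewrite take0.
have KI i : i \in J -> K :&: vclass q i = [set v in take (a i) (enum (S i))].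
  move=> iJ; apply/setP=> v; rewrite !inE.
  have [->|vi] := eqVneq v.1 i; rewrite ?andbT // andbF; symmetry.
  apply: contraNF vi => /mem_take; rewrite mem_enum => /(subsetP (subS i iJ)).
  by rewrite inE.
have cardK i : #|K :&: vclass q i| = a i.
  have [iJ|iJ] := boolP (i \in J); last first.
    have /eqP-> : a i == 0 by rewrite -leqn0 leqNgt a_gt0.
    apply/eqP; rewrite cards_eq0; apply/eqP/setP=> v; rewrite in_setI in_set0.
    by apply: contraNF iJ => /andP[/memK[vJ _]]; rewrite inE => /eqP<-.
  rewrite KI // cardsE (card_uniqP _) ?take_uniq ?enum_uniq //.
  by rewrite size_takel // -cardE (leq_trans (nth_leq_largest_part _)) ?leS.
exists K; first exact: edge_of_sizes sjs cardK.
split=> // i iJ; have : K :&: vclass q i != set0.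
  by rewrite -card_gt0 cardK a_gt0.
case/set0Pn=> v; rewrite inE => /andP[vK]; rewrite inE => /eqP vi.
by exists v => //; rewrite -vi; case: (memK v vK).
Qed.

(** * Edges with few or many colours under a fixed colouring *)

Variable c : vertex n q -> nat.

(** Taking for [S i] the vertices of colour [f i] in class [i] reduces the colours of an edge to
    those of its classes. *)
Lemma edge_of_monochromatic (J : {set 'I_n}) (f : 'I_n -> nat) :
  #|J| = size sigma ->
  {in J, forall i, largest_part sigma <= #|[set v in vclass q i | c v == f i]|} ->
  exists2 K, K \in H & ncolours c K = ncolours f J.
Proof.
move=> cardJ leJ.
have subS i : i \in J -> [set v in vclass q i | c v == f i] \subset vclass q i.
  by move=> _; apply/subsetP=> v; rewrite inE => /andP[].
have [K KH [memK exK]] := edge_inside cardJ subS leJ; exists K => //.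
apply/eqP; rewrite eqn_leq; apply/andP; split; apply: leq_ncolours.
  move=> v /memK[vJ]; rewrite !inE mem_undup => /andP[_ /eqP->].
  exact: image_f.
move=> i /exK[v vK]; rewrite inE => /andP[_ /eqP<-].
by rewrite mem_undup image_f.
Qed.

(** The classes are treated one by one. Each shows at least [m] colours, so every chosen vertex can
    bring a new colour until [m] are reached. *)
Lemma colourful_of_sizes m (js : seq 'I_n) (a : seq nat) :
  uniq js -> size js = size a -> {in a, forall x, x <= q} ->
  {in js, forall i, m <= ncolours c (vclass q i)} ->
  exists2 K : {set vertex n q},
    forall i, #|K :&: vclass q i| = nth 0 a (index i js)
    & minn m (sumn a) <= ncolours c K.
Proof.
elim: js a => [|j js IHjs] [|x a] //=.
  move=> _ _ _ _; exists set0; last by rewrite minn0.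
  by move=> i; rewrite set0I cards0.
case/andP=> jjs ujs [sjs] leq_a leq_js.
have [||K sizeK leK] := IHjs a ujs sjs.
- by move=> y ya; apply: leq_a; rewrite inE ya orbT.
- by move=> i ijs; apply: leq_js; rewrite inE ijs orbT.
have xq : x <= #|vclass q j| by rewrite card_vclass leq_a ?mem_head.
have mj := leq_js j (mem_head _ _).
have [Y [Yj cardY leY]] := exists_colourful K xq mj.
exists (K :|: Y); last lia.
move=> i; rewrite setIUl eq_sym.
have [->|ij] := eqVneq i j.
  rewrite (setIidPl Yj) (_ : K :&: _ = set0) ?set0U //.
  by apply/eqP; rewrite -cards_eq0 sizeK nth_default // -sjs memNindex.
rewrite (_ : Y :&: _ = set0) ?setU0 ?sizeK //.
apply/setP=> v; rewrite !inE; apply: contraNF ij => /andP[/(subsetP Yj)].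
by rewrite inE => /eqP-> /eqP->.
Qed.

Lemma edge_of_colourful m (J : {set 'I_n}) :
  m <= r -> #|J| = size sigma -> largest_part sigma <= q ->
  {in J, forall i, m <= ncolours c (vclass q i)} ->
  exists2 K, K \in H & m <= ncolours c K.
Proof.
move=> le_mr cardJ le_q leJ.
have sjs : size (enum J) = size sigma by rewrite -cardE.
have [||K sizeK] := colourful_of_sizes (m := m) (enum_uniq J) sjs.
- by move=> x /leq_largest_part /leq_trans->.
- by move=> i; rewrite mem_enum; apply: leJ.
rewrite sumn_sigma (minn_idPl le_mr) => leK; exists K => //.
exact: edge_of_sizes (enum_uniq _) sjs sizeK.
Qed.

(* A class in which no colour is repeated [Delta] times has more than [beta]
   colours, so unless [s] such classes produce an edge with more than [beta]
   colours, all but [s - 1] classes contain [Delta] equicoloured vertices. *)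
Lemma many_monochromatic beta :
  beta < r -> beta * (largest_part sigma - 1) + 1 <= q ->
  0 < beta -> 0 < size sigma ->
  (exists2 K, K \in H & beta < ncolours c K) \/
  (exists (A : {set 'I_n}) (f : 'I_n -> nat), n < #|A| + size sigma /\
    {in A, forall i,
      largest_part sigma <= #|[set v in vclass q i | c v == f i]|}).
Proof.
move=> lt_br le_q beta_gt0 s_gt0; set Delta := largest_part sigma.
have le_Dq : Delta <= q by rewrite /Delta; nia.
have Delta_gt0 : 0 < Delta.
  have [x xs]: exists x, x \in sigma.
    by case: (sigma) s_gt0 => // x a; exists x; rewrite mem_head.
  exact: leq_trans (part_gt0 xs) (leq_largest_part xs).
pose good i v := Delta <= #|[set u in vclass q i | c u == c v]|.
pose f i := if [pick v | good i v] is Some v then c v else 0.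
pose A := [set i | [exists v, good i v]].
have [/exists_subset_card[J JA cardJ]|ltA] := leqP (size sigma) #|~: A|.
  left; apply: edge_of_colourful cardJ le_Dq _ => // i /(subsetP JA).
  rewrite !inE => /existsPn bad.
  (* [bad] only concerns colours of vertices; a colour absent from the class is counted zero
     times. *)
  have leD d : #|[set v in vclass q i | c v == d]| <= Delta - 1.
    have [->|[v]] := set_0Vmem [set v in vclass q i | c v == d].
      by rewrite cards0.
    rewrite inE => /andP[_ /eqP<-]; have := bad v; rewrite /good; lia.
  (* With at most [beta] colours the class would have at most [beta * (Delta - 1) < q] vertices. *)
  have := card_leq_ncolours leD; rewrite card_vclass -/Delta in le_q *; nia.
right; exists A, f; split.
  by rewrite -[X in X < _]card_ord -(cardsC A) ltn_add2l.
move=> i; rewrite inE => /existsP[v gv]; rewrite /f.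
by case: pickP => [u //|/(_ v)]; rewrite gv.
Qed.

(** An edge meets exactly [s] of the [n] classes, and each of its parts lies in a class of [q]
    vertices. *)
Lemma nonempty_bounds :
  H != set0 -> size sigma <= n /\ largest_part sigma <= q.
Proof.
case/set0Pn=> K; rewrite inE => /andP[_ permK]; split.
  rewrite -(perm_size permK) size_filter (leq_trans (count_size _ _)) //.
  by rewrite size_map -cardE card_ord.
apply/bigmax_leqP_seq => m ms _; move: ms; rewrite -(perm_mem permK) mem_filter.
case/andP=> _ /imageP[i _ ->].
by rewrite -[leqRHS](card_vclass i); apply/subset_leq_card/subsetIr.
Qed.

Lemma monochromatic_classes_colour :
  monochromatic_classes c -> H != set0 ->
  exists f : 'I_n -> nat, forall i,
    largest_part sigma <= #|[set v in vclass q i | c v == f i]|.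
Proof.
move=> mono /nonempty_bounds[_ le_q].
(* The default [0] arises only for an empty class. *)
pose f i := if [pick v in vclass q i] is Some v then c v else 0.
exists f => i; apply: leq_trans le_q _; rewrite -[leqLHS](card_vclass i).
apply/subset_leq_card/subsetP=> v vi; rewrite inE vi /f /=.
by case: pickP => [u ui|/(_ v)]; rewrite ?vi //; apply/eqP/(mono i).
Qed.

End Edges.

Theorem theorem3p4 (r : nat) (sigma : seq nat) (n q alpha beta : nat)
    (r_gt0 : 0 < r) (sigma_part : is_partition sigma r)
    (n_gt0 : 0 < n) (q_gt0 : 0 < q)
    (alpha_ge2 : 2 <= alpha) (le_alpha_beta : alpha <= beta) :
  let s := size sigma in
  let Delta := largest_part sigma in
  let H := sigma_hypergraph n q r sigma in
  [/\ H != set0 -> s < alpha -> alpha <= beta ->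
        forall k : nat, ~ monochromatic_zone n q r sigma alpha beta k,
      H != set0 -> alpha <= beta -> beta < s ->
        (beta - alpha + 1) * ((s - 1) %/ (alpha - 1)) + s <= n ->
        forall k : nat, ~ monochromatic_zone n q r sigma alpha beta k,
      1 <= s -> s < alpha -> alpha <= beta -> beta < r ->
        beta * (Delta - 1) + 1 <= q -> 2 * s - 1 <= n ->
        (forall c : vertex n q -> nat, exists K : {set vertex n q},
           K \in H /\ (ncolours c K < alpha \/ beta < ncolours c K))
        /\ ~ (exists c : vertex n q -> nat, colouring H alpha beta c)
    & 1 < alpha -> alpha <= beta -> beta < s -> s < r ->
        beta * (Delta - 1) + 1 <= q ->
        ((s - 1) %/ (alpha - 1)) * (s - alpha) + 2 * s - 1 <= n ->
        (forall c : vertex n q -> nat, exists K : {set vertex n q},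
           K \in H /\ (ncolours c K < alpha \/ beta < ncolours c K))
        /\ ~ (exists c : vertex n q -> nat, colouring H alpha beta c)].
Proof.
move=> s Delta H.
have no_colouring :
    (forall c : vertex n q -> nat, exists K : {set vertex n q},
       K \in H /\ (ncolours c K < alpha \/ beta < ncolours c K)) ->
    ~ (exists c : vertex n q -> nat, colouring H alpha beta c).
  move=> bad [c col]; have [K [KH badK]] := bad c.
  have := col K KH; lia.
have few_colours (c : vertex n q -> nat) (A : {set 'I_n}) f :
    s <= #|A| -> s < alpha ->
    {in A, forall i, Delta <= #|[set v in vclass q i | c v == f i]|} ->
    exists2 K, K \in H & ncolours c K < alpha.
  move=> /exists_subset_card[J JA cardJ] lt_sa leA.
  have [|K KH eqK] := edge_of_monochromatic sigma_part cardJ (c := c) (f := f).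
    by move=> i /(subsetP JA); apply: leA.
  exists K => //; rewrite eqK; apply: leq_ltn_trans lt_sa.
  rewrite -cardJ cardE -(size_map f); apply: leq_ncolours => i iJ.
  by rewrite map_f ?mem_enum.
have bad_colours (c : vertex n q -> nat) (A : {set 'I_n}) f :
    (beta - alpha + 1) * ((s - 1) %/ (alpha - 1)) + s <= #|A| -> beta < s ->
    {in A, forall i, Delta <= #|[set v in vclass q i | c v == f i]|} ->
    exists K, K \in H /\ (ncolours c K < alpha \/ beta < ncolours c K).
  move=> le_A lt_bs leA.
  have [J [JA cardJ badJ]] :=
    exists_bad_subset f alpha_ge2 le_alpha_beta lt_bs le_A.
  have [|K KH eqK] := edge_of_monochromatic sigma_part cardJ (c := c) (f := f).
    by move=> i /(subsetP JA); apply: leA.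
  by exists K; rewrite eqK.
split.
- move=> H0 lt_sa _ k [c [[col _] mono]].
  have [le_sn _] := nonempty_bounds H0.
  have [f fP] := monochromatic_classes_colour mono H0.
  have [||K KH] := few_colours c setT f _ lt_sa; first by rewrite cardsT card_ord.
    by move=> i _; apply: fP.
  by have := col K KH; lia.
- move=> H0 _ lt_bs le_n k [c [[col _] mono]].
  have [f fP] := monochromatic_classes_colour mono H0.
  have [||K [KH]] := bad_colours c setT f _ lt_bs; first by rewrite cardsT card_ord.
    by move=> i _; apply: fP.
  by have := col K KH; lia.
- move=> s_gt0 lt_sa _ lt_br le_q le_n.
  suff bad : forall c : vertex n q -> nat, exists K : {set vertex n q},
      K \in H /\ (ncolours c K < alpha \/ beta < ncolours c K).
    by split=> //; apply: no_colouring.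
  move=> c; have beta_gt0 : 0 < beta by lia.
  have [[K KH ltK]|[A [f [leA fP]]]] :=
    many_monochromatic sigma_part c lt_br le_q beta_gt0 s_gt0.
    by exists K; split=> //; right.
  have [||K KH ltK] := few_colours c A f _ lt_sa => //.
    (* [#|A| >= n - s + 1 >= s], since [n >= 2 * s - 1]. *)
    by rewrite -/s in leA; lia.
  by exists K; split=> //; left.
- move=> _ _ lt_bs lt_sr le_q le_n.
  suff bad : forall c : vertex n q -> nat, exists K : {set vertex n q},
      K \in H /\ (ncolours c K < alpha \/ beta < ncolours c K).
    by split=> //; apply: no_colouring.
  move=> c; have beta_gt0 : 0 < beta by lia.
  have s_gt0 : 0 < s by lia.
  have [[K KH ltK]|[A [f [leA fP]]]] :=
    many_monochromatic sigma_part c (ltn_trans lt_bs lt_sr) le_q beta_gt0 s_gt0.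
    by exists K; split=> //; right.
  apply: bad_colours (lt_bs) fP; rewrite -/s in leA.
  (* As [beta < s], the factor [beta - alpha + 1] is at most [s - alpha]; the remaining [2 * s - 1]
     in the bound on [n] pays for the [s - 1] lost classes and the summand [s]. *)
  have : (beta - alpha + 1) * ((s - 1) %/ (alpha - 1))
      <= (s - 1) %/ (alpha - 1) * (s - alpha).
    by rewrite mulnC leq_mul2l; apply/orP; right; lia.
  lia.
Qed.
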